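(* $\mathrm{non}({\sf Split}(\Lambda,\Lambda))=\mathfrak{r}$; that is, the minimum cardinality of a set of real numbers which fails to have property ${\sf Split}(\Lambda,\Lambda)$ equals the reaping number $\mathfrak{r}$.
   Context: ''Cover'' means countable open cover. For a set $X$ of reals, a cover $\mathcal{U}$ of $X$ is large if each $x\in X$ belongs to infinitely many members of $\mathcal{U}$; $\Lambda$ denotes the family of large covers. $X$ has ${\sf Split}(\Lambda,\Lambda)$ if every large cover $\mathcal{U}$ of $X$ can be partitioned into two subfamilies $\mathcal{U}_0,\mathcal{U}_1$ each of which is a large cover of $X$. A family $\mathcal{R}\subseteq[\omega]^\omega$ is reaping if for each $x\in[\omega]^\omega$ there is $y\in\mathcal{R}$ with $y\subseteq^* x$ or $y\subseteq^*\omega\setminus x$ ($\subseteq^*$ means inclusion modulo a finite set); $\mathfrak{r}$ is the minimal cardinality of a reaping family. *)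

(* Defs.v *)
From mathcomp Require Import all_boot all_order all_algebra.
From mathcomp Require Import all_classical all_reals topology normedtype.
Import numFieldNormedType.Exports.

Set Implicit Arguments.
Unset Strict Implicit.
Unset Printing Implicit Defensive.

Local Open Scope classical_set_scope.
Local Open Scope card_scope.

(* The members of a cover of [X] are open sets of the subspace [X], i.e.
   traces on [X] of open sets of the ambient space, so that families are
   taken up to equality of these traces. [X] itself may be a member. *)
Definition large_cover (T : topologicalType) (X : set T) (U : set (set T)) :
    Prop :=
  [/\ countable U,
      U `<=` [set V `&` X | V in open] &
      forall x, X x -> infinite_set [set V | U V /\ V x]].

(* The two parts of the partition are not required to be nonempty. This only
   matters for [X = set0], where the empty family is a large cover. *)
Definition split_large (T : topologicalType) (X : set T) : Prop :=
  forall U : set (set T), large_cover X U ->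
    exists U0 U1 : set (set T),
      [/\ U0 `|` U1 = U, U0 `&` U1 = set0, large_cover X U0 & large_cover X U1].

Definition almost_subset (x y : set nat) : Prop := finite_set (x `\` y).

Definition reaping (F : set (set nat)) : Prop :=
  F `<=` [set y | infinite_set y] /\
  forall x : set nat, infinite_set x ->
    exists2 y, F y & almost_subset y x \/ almost_subset y (~` x).

(* [A] realizes the minimum of the cardinalities of the sets satisfying [P]. *)
Definition has_min_card (T : Type) (P : set T -> Prop) (A : set T) : Prop :=
  P A /\ forall B : set T, P B -> A #<= B.

(* Main.v *)
(** Enumerate a large cover of [X] injectively as [U_n] and let [a x] be the set
    of the [n] with [x] in [U_n]. A splitting of the cover is the same thing as
    a [z] such that [a x `&` z] and [a x `\` z] are infinite for all [x], so if
    there is none then the [a x] form a reaping family. Conversely, embed a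
    reaping family into the reals by ternary expansions, and cover its image
    by the traces [U_n] of the sets of [y] containing [n]. Distinct [n] may
    have equal traces and then count only once, so one keeps a single
    representative [n] for each trace and first recodes the members of the
    family as infinite sets of representatives. *)

Require Import Defs.
From mathcomp Require Import all_boot all_order all_algebra.
From mathcomp Require Import all_classical all_reals topology normedtype.
From mathcomp Require Import lra.
Import numFieldNormedType.Exports.
Import Order.TTheory GRing.Theory Num.Theory.

Set Implicit Arguments.
Unset Strict Implicit.
Unset Printing Implicit Defensive.

Local Open Scope classical_set_scope.
Local Open Scope card_scope.

(** * Infinite sets and minimum cardinalities *)

Lemma injective_infinite_image (T U : Type) (f : T -> U) (A : set T) :
  {in A &, injective f} -> infinite_set A -> infinite_set (f @` A).
Proof.
move=> fI Ainf; apply: contra_not Ainf; apply: card_le_finite.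
by have := inj_card_eq fI; rewrite card_eq_le => /andP[].
Qed.

Lemma infinite_set_halve (T : Type) (C : set T) : infinite_set C ->
  exists D, infinite_set (C `&` D) /\ infinite_set (C `\` D).
Proof.
elim/Ppointed: T C => T C; first by rewrite emptyE.
move=> /infiniteP/pcard_leP[g].
have gI m n : g m = g n -> m = n by apply: (@inj _ _ _ g); rewrite inE.
exists (range (fun n => g n.*2)); split.
  apply: (@sub_infinite_set _ (range (fun n => g n.*2))).
    by move=> _ [n _ <-]; split; [exact: funS|exists n].
  apply: injective_infinite_image infinite_nat.
  by move=> m n _ _ /gI; exact: double_inj.
apply: (@sub_infinite_set _ (range (fun n => g n.*2.+1))).
  move=> _ [n _ <-]; split; first exact: funS.
  by move=> [m _ /gI /(congr1 odd)]; rewrite /= !odd_double.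
apply: injective_infinite_image infinite_nat.
by move=> m n _ _ /gI[]; exact: double_inj.
Qed.

(* Zorn's lemma applied to families of pairwise everywhere-distinct choice
   functions: a maximal family [M] exhausts some [A], and evaluation at any
   [B] is then an injection of [A], through [M], into [B]. *)
Lemma has_min_card_exists (T : Type) (P : set T -> Prop) (A0 : set T) :
  P A0 -> exists A, has_min_card P A.
Proof.
move=> PA0.
pose good (M : set (set T -> T)) :=
  (forall f A, M f -> P A -> A (f A)) /\
  forall f g A, M f -> M g -> P A -> f A = g A -> f = g.
have [S SP totS|M [[Min Minj] Mmax]] := @Zorn_bigcup _ good.
  split=> [f A [M SM Mf]|f g A [M SM Mf] [N SN Ng]].
    by have [+ _] := SP _ SM; apply.
  have [MN|NM] := totS _ _ SM SN.
    by have [_] := SP _ SN; apply=> //; exact: MN.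
  by have [_] := SP _ SM; apply=> //; exact: NM.
have [[A [PA AM]]|noA] :=
    pselect (exists A, P A /\ A `<=` (fun f => f A) @` M).
  exists A; split=> // B PB.
  apply: (card_le_trans (subset_card_le AM)).
  apply: (card_le_trans (card_image_le _ _)).
  have fI : {in M &, injective (fun f : set T -> T => f B)}.
    by move=> f g /set_mem Mf /set_mem Mg; exact: Minj.
  have := inj_card_eq fI; rewrite card_eq_le => /andP[_ MB].
  apply: (card_le_trans MB); apply: subset_card_le => _ [f Mf <-].
  exact: (Min f B).
(* If [M] exhausts no set satisfying [P], choosing a missed point in each such set gives an [h] that
   properly enlarges [M]. *)
have out A : P A -> exists t, A t /\ ~ ((fun f => f A) @` M) t.
  move=> PA; apply/not_existsP => nt; apply: noA; exists A; split=> // t At.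
  by apply: contrapT => Mt; apply: (nt t).
(* [t0] is the default value of [h] at sets outside [P]. *)
have [t0 _] := out _ PA0.
have /choice[h hP] : forall A, exists t, P A -> A t /\ ~ ((fun f => f A) @` M) t.
  move=> A; have [/out[t ?]|nPA] := pselect (P A); first by exists t.
  by exists t0.
exfalso; apply: (Mmax (M `|` [set h])).
  split; first by move=> f Mf; left.
  move=> /(_ h (or_intror erefl)) Mh.
  by have [_] := hP _ PA0; apply; exists h.
split=> [f A [Mf|->] PA|f g A [Mf|->] [Mg|->] PA fg //].
- exact: (Min f A).
- by have [] := hP _ PA.
- exact: (Minj _ _ A).
- by have [_] := hP _ PA; case; exists f.
- by have [_] := hP _ PA; case; exists g.
Qed.

(** * From unsplittable covers to reaping families *)

Definition splits (z y : set nat) : Prop :=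
  infinite_set (y `&` z) /\ infinite_set (y `\` z).

Lemma almost_subsetC (y z : set nat) :
  almost_subset y (~` z) = finite_set (y `&` z).
Proof. by rewrite /almost_subset setDE setCK. Qed.

Lemma reaping_nsplits (F : set (set nat)) (z : set nat) :
  reaping F -> (forall y, F y -> splits z y) -> False.
Proof.
move=> [_ Freap] Fz.
(* [y0] serves to show that [z] is infinite, since reaping is tested on infinite sets only. *)
have [y0 Fy0 _] := Freap _ infinite_nat.
have [y Fy] : exists2 y, F y & almost_subset y z \/ almost_subset y (~` z).
  apply: Freap; have [+ _] := Fz _ Fy0; apply: sub_infinite_set.
  exact: subIsetr.
by have [yz ynz] := Fz _ Fy; rewrite almost_subsetC => -[].
Qed.

Lemma not_split_large_reaping (T : topologicalType) (X : set T) :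
  ~ split_large X -> exists2 F, reaping F & F #<= X.
Proof.
move=> nsplit; apply: contrapT => noF; apply: nsplit => U [Ucnt Uopen Uinf].
have /countable_injP[f fI] := Ucnt.
pose a x := f @` [set V | U V /\ V x].
have ainf x : X x -> infinite_set (a x).
  move=> Xx; apply: injective_infinite_image (Uinf _ Xx) => V W.
  by rewrite !inE => -[UV _] [UW _]; apply: fI; rewrite inE.
have [z az] : exists z, forall x, X x -> splits z (a x).
  apply: contrapT => noz; apply: noF; exists (a @` X); last exact: card_image_le.
  split=> [_ [x Xx <-]|z zinf]; first exact: ainf.
  apply: contrapT => nay; apply: noz; exists z => x Xx.
  have ax : (a @` X) (a x) by exists x.
  split=> fin; apply: nay; exists (a x) => //; last by left.
  by rewrite almost_subsetC; right.
have sub (A : set (set T)) : A `<=` U ->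
    (forall x, X x -> infinite_set (f @` [set V | A V /\ V x])) ->
    large_cover X A.
  move=> AU Ainf; split; first exact: sub_countable (subset_card_le AU) _.
    exact: subset_trans AU Uopen.
  by move=> x Xx; have := Ainf _ Xx; apply: contra_not; exact: finite_image.
exists (U `&` f @^-1` z), (U `\` f @^-1` z); split.
- exact: setUIDK.
- by rewrite setDE setIACA setICr setI0.
- apply: sub => [|x Xx]; first exact: subIsetl.
  have [+ _] := az _ Xx; apply: sub_infinite_set.
  by move=> _ [[V [UV Vx] <-] zV]; exists V.
- apply: sub => [|x Xx]; first exact: subDsetl.
  have [_] := az _ Xx; apply: sub_infinite_set.
  by move=> _ [[V [UV Vx] <-] zV]; exists V.
Qed.

(** * Ternary expansions of sets of naturals *)

Section ternary_expansion.
Local Open Scope ring_scope.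
Variable R : realType.
Implicit Types (y z : set nat) (n : nat).

Let q : R := 3%:R^-1.

(** With digits 0 and 1 in base 3, the tail after position [k] is at most half of [q ^+ k], so
    digits can be read off the value. *)
Definition ternary_partial y n : R := \sum_(k < n | nat_of_ord k \in y) q ^+ k.

Definition ternary y : R := sup (range (ternary_partial y)).

Let q_gt0 n : 0 < q ^+ n. Proof. by rewrite exprn_gt0// invr_gt0. Qed.

Lemma ternary_partialS y n :
  ternary_partial y n.+1 = ternary_partial y n + (n \in y)%:R * q ^+ n.
Proof.
rewrite /ternary_partial big_mkcond big_ord_recr /= -big_mkcond.
by case: (n \in y); rewrite (mul1r, mul0r).
Qed.

(** The factor [3 / 2] is the sum of all powers of [q], so [3 / 2 * q ^+ n] is the largest possible
    tail from [n] on. *)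
Let partial_tail y n m : (n <= m)%N ->
  ternary_partial y n <= ternary_partial y m /\
  ternary_partial y m + 3 / 2 * q ^+ m <= ternary_partial y n + 3 / 2 * q ^+ n.
Proof.
elim: m => [|m IH]; first by rewrite leqn0 => /eqP ->.
rewrite leq_eqVlt => /predU1P[->//|]; rewrite ltnS => /IH[le1 le2].
have qm := q_gt0 m.
have qS : q ^+ m.+1 = q ^+ m / 3 by rewrite exprSr.
rewrite ternary_partialS qS.
case: (m \in y) => /=; rewrite ?(mul1r, mul0r); split; lra.
Qed.

Lemma ternary_bounds y n :
  ternary_partial y n <= ternary y <= ternary_partial y n + 3 / 2 * q ^+ n.
Proof.
have ub : ubound (range (ternary_partial y))
            (ternary_partial y n + 3 / 2 * q ^+ n).
  move=> _ [m _ <-]; have [nm|/ltnW mn] := leqP n m.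
    by have [_] := partial_tail y nm; have := q_gt0 m; lra.
  by have [+ _] := partial_tail y mn; have := q_gt0 n; lra.
apply/andP; split; first by apply: ub_le_sup; [eexists; exact: ub|exists n].
by apply: ge_sup ub; exists (ternary_partial y 0%N), 0%N.
Qed.

(** If the first difference is at [k <= n], the values are at least [q ^+ k - 3 / 2 * q ^+ k.+1]
    apart; this is [2^-1 * q ^+ k], hence at least [2^-1 * q ^+ n]. *)
Lemma ternary_close y z n : `|ternary y - ternary z| < 2^-1 * q ^+ n ->
  (n \in y) = (n \in z).
Proof.
rewrite ltr_norml => /andP[lt1 lt2].
have qS k : q ^+ k.+1 = q ^+ k / 3 by rewrite exprSr.
have step k : (k <= n)%N -> ternary_partial y k = ternary_partial z k ->
    (k \in y) = (k \in z).
  move=> kn eqk.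
  have qnk : q ^+ n <= q ^+ k.
    by apply: ler_wiXn2l => //; rewrite /q; lra.
  have := ternary_bounds y k.+1; have := ternary_bounds z k.+1.
  rewrite !ternary_partialS eqk qS.
  by case: (k \in y); case: (k \in z) => //=;
    rewrite ?(mul1r, mul0r) => /andP[? ?] /andP[? ?]; exfalso; lra.
have eqp k : (k <= n)%N -> ternary_partial y k = ternary_partial z k.
  elim: k => [_|k IH kn]; first by rewrite /ternary_partial !big_ord0.
  have ek := IH (ltnW kn).
  by rewrite !ternary_partialS ek (step k (ltnW kn) ek).
exact: step (eqp _ (leqnn n)).
Qed.

Lemma ternary_open n : exists2 V : set R, open V &
  forall y, V (ternary y) <-> y n.
Proof.
have d0 : 0 < 2^-1 * q ^+ n by rewrite mulr_gt0// invr_gt0.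
exists (\bigcup_(y in [set y | y n]) ball (ternary y) (2^-1 * q ^+ n)).
  by apply: bigcup_open => y _; exact: ball_open.
move=> y; split=> [[z /= zn]|yn]; last by exists y => //; exact: ballxx.
by rewrite -ball_normE /= => /ternary_close; rewrite (mem_set zn) => /esym/set_mem.
Qed.

End ternary_expansion.

(** * Indices not separated by a family, and their representatives *)

Section separating_recode.
Variable F : set (set nat).

Definition twins (n : nat) : set nat := [set m | forall y, F y -> y n <-> y m].

(* The least elements of the classes of [twins]: the members of [F] separate
   the points of this set. *)
Definition twin_reps : set nat :=
  [set n | forall m, twins n m -> (n <= m)%N].

Lemma twins_sub (y : set nat) n : F y -> y n -> twins n `<=` y.
Proof. by move=> Fy yn m /(_ _ Fy)[+ _]; apply. Qed.

Lemma twins_eq n m : twins n m -> twins n = twins m.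
Proof.
by move=> nm; apply/seteqP; split=> k nk y Fy;
  [rewrite -(nm _ Fy)|rewrite (nm _ Fy)]; exact: nk.
Qed.

Lemma twin_reps_exists n : exists2 g, twin_reps g & twins g n.
Proof.
have exP : exists m, `[< twins n m >] by exists n; apply/asboolP => y _.
case: (ex_minnP exP) => g /asboolP ng gmin; exists g.
  by move=> m gm; apply: gmin; apply/asboolP; rewrite (twins_eq ng).
by rewrite -(twins_eq ng) => y _.
Qed.

Lemma twin_reps_inj n m : twin_reps n -> twin_reps m -> twins n m -> n = m.
Proof.
move=> Gn Gm nm; apply/eqP; rewrite eqn_leq Gn//= Gm// => y Fy.
by rewrite (nm _ Fy).
Qed.

(** The classes of the representatives in [y] cover [y]; finitely many finite classes would make it
    finite. *)
Lemma twins_infinite (y : set nat) : F y -> infinite_set y ->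
  finite_set (y `&` twin_reps) -> exists2 n, y n & infinite_set (twins n).
Proof.
move=> Fy yinf yGfin; apply: contrapT => nex; apply: yinf.
apply: (@sub_finite_set _ _ (\bigcup_(g in y `&` twin_reps) twins g)).
  move=> n yn; have [g Gg gn] := twin_reps_exists n; exists g => //.
  by split=> //; have [_] := gn _ Fy; apply.
apply: bigcup_finite => // g [yg _]; apply: contrapT => ginf; apply: nex.
by exists g.
Qed.

(* [y] contains a whole infinite class when its trace on [twin_reps] is
   finite, so such [y] can all be split classwise; their trace is replaced by
   its complement, which is infinite and still separates the same points. *)
Definition recode (y : set nat) : set nat :=
  if `[< finite_set (y `&` twin_reps) >] then twin_reps `\` y
  else y `&` twin_reps.

Lemma recodeE (y : set nat) n m : twin_reps n -> twin_reps m ->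
  (recode y n <-> recode y m) -> (y n <-> y m).
Proof.
move=> Gn Gm; have [yn|yn] := pselect (y n); have [ym|ym] := pselect (y m);
  by rewrite /recode; case: asboolP => _; rewrite /setI /setD /=; tauto.
Qed.

Lemma recode_sub y : recode y `<=` twin_reps.
Proof. by rewrite /recode; case: asboolP => _ n []. Qed.

Lemma infinite_recode y : infinite_set twin_reps -> infinite_set (recode y).
Proof.
move=> Ginf; rewrite /recode; case: asboolP => // fin; apply: contra_not Ginf.
by move=> fin'; rewrite -(setUIDK twin_reps y) finite_setU setIC.
Qed.

Lemma splits_of_recode (z : set nat) :
  F `<=` [set y | infinite_set y] ->
  (forall y, F y -> infinite_set (y `&` twin_reps) ->
     splits z (y `&` twin_reps)) ->
  exists w, forall y, F y -> splits w y.
Proof.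
move=> Finf zsplit.
have /choice[h hP] : forall C : set nat, exists D, infinite_set C -> splits D C.
  move=> C; have [/infinite_set_halve[D ?]|fin] := pselect (infinite_set C).
    by exists D.
  by exists set0.
(* On representatives the splitter follows [z]; elsewhere it halves each infinite class, [h]
   depending on [n] only through its class. *)
exists [set n | (twin_reps n /\ z n) \/ (~ twin_reps n /\ h (twins n) n)].
move=> y Fy; have [fin|inf] := pselect (finite_set (y `&` twin_reps)).
  have [n yn ninf] := twins_infinite Fy (Finf _ Fy) fin.
  have [g Gg gn] := twin_reps_exists n.
  (* The class has a single representative, [g]; dropping it keeps both halves infinite and puts
     them outside [twin_reps]. *)
  have cut (A : set nat) : infinite_set A -> infinite_set (A `\ g).
    apply: contra_not => fin'; rewrite -(setUIDK A [set g]) finite_setU.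
    by split=> //; exact: sub_finite_set (@subIsetr _ _ _) (finite_set1 g).
  have nG m : twins n m -> m <> g -> ~ twin_reps m.
    move=> nm mg Gm; apply: mg; apply: esym; apply: twin_reps_inj => //.
    by rewrite (twins_eq gn).
  have [h1 h2] := hP _ ninf.
  split; [move: (cut _ h1)|move: (cut _ h2)]; apply: sub_infinite_set.
    move=> m [[nm hm] mg]; split; first exact: twins_sub nm.
    by right; rewrite -(twins_eq nm); split=> //; exact: nG mg.
  move=> m [[nm hm] mg]; split; first exact: twins_sub nm.
  move=> [[Gm _]|[_]]; first exact: (nG m).
  by rewrite -(twins_eq nm).
have [h1 h2] := zsplit _ Fy inf.
split; [move: h1|move: h2]; apply: sub_infinite_set => m [[ym Gm] zm]; split=> //.
  by left.
by case=> -[].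
Qed.

End separating_recode.

(** * From reaping families to unsplittable covers *)

Lemma reaping_not_split_large (R : realType) (F : set (set nat)) :
  reaping F -> exists2 X : set R, ~ split_large X & X #<= F.
Proof.
move=> reapF; have [Finf _] := reapF.
pose e y := ternary R (recode F y); pose X := e @` F.
exists X; last exact: card_image_le.
move=> splitX.
suff [z zP] : exists z, forall y, F y ->
    infinite_set (y `&` twin_reps F) -> splits z (y `&` twin_reps F).
  have [w wP] := splits_of_recode Finf zP.
  exact: reaping_nsplits reapF wP.
(* With finitely many representatives no trace is infinite, so any [z] works. *)
have [Gfin|Ginf] := pselect (finite_set (twin_reps F)).
  by exists set0 => y _ []; apply: sub_finite_set Gfin; exact: subIsetr.
have /choice[V VP] : forall n, exists V : set R, open V /\
    forall y, V (ternary R y) <-> y n.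
  by move=> n; have [V ? ?] := @ternary_open R n; exists V.
pose W n := V n `&` X; pose U := W @` twin_reps F.
have We n y : F y -> W n (e y) <-> recode F y n.
  move=> Fy; split=> [[/(VP n).2 //]|yn]; split; first exact/(VP n).2.
  by exists y.
(* Recoding keeps representatives separated, so an infinite recoded set yields infinitely many
   distinct members of [U]. *)
have WI : {in twin_reps F &, injective W}.
  move=> n m /set_mem Gn /set_mem Gm Wnm; apply: (twin_reps_inj Gn Gm) => y Fy.
  apply: (recodeE Gn Gm).
  by rewrite -(We n y Fy) -(We m y Fy) Wnm.
have Ularge : large_cover X U.
  split; first exact: card_le_trans (card_image_le _ _) (countableP _).
    by move=> _ [n _ <-]; exists (V n) => //; have [] := VP n.
  move=> _ [y Fy <-].
  apply: (@sub_infinite_set _ (W @` recode F y)).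
    move=> _ [n yn <-]; split; last exact/We.
    by exists n => //; exact: recode_sub yn.
  apply: (injective_infinite_image _ (infinite_recode Ginf)).
  move=> n m /set_mem /recode_sub Gn /set_mem /recode_sub Gm.
  by apply: WI; rewrite inE.
have [U0 [U1 [U01 U01d [_ _ U0inf] [_ _ U1inf]]]] := splitX _ Ularge.
exists [set n | U0 (W n)] => y Fy yGinf.
have yE : y `&` twin_reps F = recode F y.
  by rewrite /recode; case: asboolP.
have Xe : X (e y) by exists y.
(* [W] maps these indices onto the members of [A] containing [e y], so finitely many indices would
   mean finitely many members. *)
have trace (A : set (set R)) : A `<=` U ->
    infinite_set [set O | A O /\ O (e y)] ->
    infinite_set (recode F y `&` [set n | A (W n)]).
  move=> AU; apply: contra_not => /(finite_image W); apply: sub_finite_set.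
  move=> O [AO Oy]; have [n Gn WO] := AU _ AO; exists n => //=.
  by split; [apply/We => //; rewrite WO|rewrite WO].
rewrite yE; split.
  by apply: trace (U0inf _ Xe); rewrite -U01; exact: subsetUl.
have := trace U1 _ (U1inf _ Xe); rewrite -U01 => /(_ (@subsetUr _ _ _)).
apply: sub_infinite_set => n [yn U1n]; split=> // U0n.
by have : (U0 `&` U1) (W n) by []; rewrite U01d.
Qed.

Theorem mainTheorem8 (R : realType) :
  exists (X : set R) (F : set (set nat)),
    [/\ has_min_card (fun Y : set R => ~ split_large Y) X,
        has_min_card reaping F &
        X #= F].
Proof.
have reap0 : reaping [set y | infinite_set y].
  split=> // x xinf; exists x => //; left.
  by rewrite /almost_subset setDv.
have [F [reapF Fmin]] := has_min_card_exists reap0.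
have [X nsX XF] := reaping_not_split_large R reapF.
have Fle (Y : set R) : ~ split_large Y -> F #<= Y.
  move=> /not_split_large_reaping[G reapG GY].
  exact: card_le_trans (Fmin _ reapG) GY.
exists X, F; split=> //.
  by split=> // Y nsY; exact: card_le_trans XF (Fle _ nsY).
by rewrite card_eq_le XF Fle.
Qed.
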